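(* Let $F=(F,\mathcal G_0,\nu)$ be an $\mathbb N$-divisibly closed supertropical semifield with set of tangible elements $\mathcal T$. Then any polynomial $f\in\mathcal T\lfloor\lambda\rfloor$ (that is, any tangible polynomial over $F$ in one indeterminate $\lambda$) is $e$-equivalent to the tangible part of a product $\prod_j(\lambda+a_j)^{i_j}$, where the $a_j$ range over ordinary roots of $f$.
   Context: All semirings are commutative (in both operations), with zero $0_R$ and unit $1_R$. A supertropical semiring is a triple $(R,\mathcal G_0,\nu)$ where $R$ is a semiring, $\mathcal G_0=\mathcal G\cup\{0_R\}$ is a semiring ideal of $R$ (the ghost ideal), and $\nu:R\to\mathcal G_0$ (written $a^\nu=\nu(a)$) is a semiring homomorphism with $\nu^2=\nu$ (where $\mathcal G_0$ is a semiring with unit $\nu(1_R)$), such that: $a+a=a^\nu$ for all $a$; $a+b\in\{a,b\}$ whenever $a^\nu\ne b^\nu$; and $a+b=a^\nu$ whenever $a^\nu=b^\nu$. $\mathcal G_0$ is totally ordered by $g\ge h\iff g+h=g$; write $a>_\nu b$ for $a^\nu>b^\nu$. It is a supertropical domain if the set $\mathcal T=R\setminus\mathcal G_0$ of tangible elements is a multiplicative Abelian monoid and $\nu|_{\mathcal T}:\mathcal T\to\mathcal G$ is onto; it is a supertropical semifield if moreover $\mathcal T$ is an Abelian group. The divisible closure $\bar R$ of a supertropical domain $R$ consists of formal roots $\sqrt[m]{a}$ ($a\in R$, $m\ge1$), with $\sqrt[m]{a}=\sqrt[m']{b}$ when $a^{m'n}=b^{mn}$ for some $n\ge 1$, product $\sqrt[m]{a}\sqrt[m']{b}=\sqrt[mm']{a^{m'}b^m}$,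 sum $\sqrt[m]{a}+\sqrt[m']{b}=\sqrt[mm']{a^{m'}+b^m}$, and $\nu(\sqrt[m]{a})=\sqrt[m]{a^\nu}$. $R$ is ($\mathbb N$-)divisibly closed if $\bar R=R$ (identifying $a$ with $\sqrt[1]{a}$). $F\lfloor\lambda\rfloor$ is the semiring of formal polynomials. A polynomial is tangible if all its (nonzero) coefficients are tangible. Two polynomials are $e$-equivalent if they define the same function $F\to F$. A monomial $h$ of a polynomial $f$ is essential if $h(a)>_\nu f_h(a)$ for some $a\in F$, where $f_h$ is the sum of the other monomials; the essential part $f^{\mathrm{es}}$ is the sum of the essential monomials. The tangible part of a polynomial is the sum of those monomials of its essential part whose coefficients are tangible. For $f^{\mathrm{es}}=\sum_i\alpha_i\lambda^i$ (sum over the $i$ with $\alpha_i\neq 0_F$) and $a\in F$, put $c_i=\alpha_ia^i$. If the maximal value among the $c_i^\nu$ is attained by at least two indices $i$, then $a$ is a corner root of $f$; a tangible corner root is ordinary if all the $c_i$ of maximal $\nu$-value are tangible.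
   Formalization: The product is multiplied by αλ^l (α the leading coefficient of f, λ^l the largest power of λ dividing f; this is 1 if f is monic with f(0)≠0), and some tangible a with a^ν≠1^ν is assumed; otherwise f=α≠1, f=λ, or f=λ+1 over {0,1,1^ν} are counterexamples. *)

(* Defs.v *)
From HB Require Import structures.
From mathcomp Require Import all_boot all_order all_algebra.
From mathcomp Require Import boolp.
Set Implicit Arguments.
Unset Strict Implicit.
Unset Printing Implicit Defensive.
Import GRing.Theory.
Local Open Scope ring_scope.

Section Semirings.
Variables (R : comNzSemiRingType) (G0 : {pred R}) (nu : R -> R).

(* The total order of the ghost ideal: g >= h iff g + h = g. That it is total
   on G0 is a consequence of the axioms below. *)
Definition ghost_ge (g h : R) : Prop := g + h = g.

Definition nu_ge (a b : R) : Prop := ghost_ge (nu a) (nu b).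
Definition nu_gt (a b : R) : Prop := nu_ge a b /\ nu a <> nu b.

(* In a supertropical semiring G0 = [pred a | a + a == a], so taking G0 to be
   a boolean predicate loses no generality. *)
Record supertropical_semiring : Prop := SupertropicalSemiring {
  ghost0 : 0 \in G0;
  ghostD : forall a b, a \in G0 -> b \in G0 -> a + b \in G0;
  ghostM : forall a b, b \in G0 -> a * b \in G0;
  nu_ghost : forall a, nu a \in G0;
  nu0 : nu 0 = 0;
  nuD : forall a b, nu (a + b) = nu a + nu b;
  nuM : forall a b, nu (a * b) = nu a * nu b;
  nu1_unit : forall g, g \in G0 -> nu 1 * g = g;
  nu_idem : forall a, nu (nu a) = nu a;
  st_addaa : forall a, a + a = nu a;
  st_add_neq : forall a b, nu a <> nu b -> a + b = a \/ a + b = b;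
  st_add_eq : forall a b, nu a = nu b -> a + b = nu a
}.

Definition tangible : {pred R} := [pred a | a \notin G0].

Record supertropical_domain : Prop := SupertropicalDomain {
  stdom_semiring : supertropical_semiring;
  tangible1 : 1 \in tangible;
  tangibleM : forall a b, a \in tangible -> b \in tangible ->
    a * b \in tangible;
  nu_tangible_neq0 : forall a, a \in tangible -> nu a <> 0;
  nu_tangible_onto : forall g, g \in G0 -> g <> 0 ->
    exists2 a, a \in tangible & nu a = g
}.

Record supertropical_semifield : Prop := SupertropicalSemifield {
  stfield_domain : supertropical_domain;
  tangibleV : forall a, a \in tangible ->
    exists2 b, b \in tangible & a * b = 1
}.

(* Equality, in the divisible closure, of the m-th formal root of a and the
   m'-th formal root of b (for m, m' >= 1). *)
Definition root_eq (m : nat) (a : R) (m' : nat) (b : R) : Prop :=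
  exists2 n : nat, (0 < n)%N & a ^+ (m' * n) = b ^+ (m * n).

(* The canonical map from R to its divisible closure, sending b to its formal
   first root, is onto. Its injectivity (torsion-freeness) is not demanded. *)
Definition divisibly_closed : Prop :=
  forall (m : nat) (a : R), (0 < m)%N -> exists b : R, root_eq m a 1 b.

Implicit Types f g : {poly R}.

Definition tangible_poly f : Prop :=
  forall i, f`_i != 0 -> f`_i \in tangible.

Definition e_equiv f g : Prop := forall x : R, f.[x] = g.[x].

Definition monomial f (i : nat) : {poly R} := f`_i *: 'X^i.

Definition other_monomials f (i : nat) : {poly R} :=
  \sum_(j < size f | j != i :> nat) monomial f j.

Definition essential f (i : nat) : Prop :=
  exists a : R, nu_gt (monomial f i).[a] (other_monomials f i).[a].

Definition essential_part f : {poly R} :=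
  \sum_(i < size f | `[< essential f i >]) monomial f i.

Definition tangible_part f : {poly R} :=
  \sum_(i < size (essential_part f) | (essential_part f)`_i \in tangible)
    monomial (essential_part f) i.

Definition dominant f (a : R) (i : nat) : Prop :=
  let fes := essential_part f in
  fes`_i != 0 /\
  forall j, fes`_j != 0 -> nu_ge (fes`_i * a ^+ i) (fes`_j * a ^+ j).

Definition corner_root f (a : R) : Prop :=
  exists i j, [/\ i <> j, dominant f a i & dominant f a j].

Definition ordinary_root f (a : R) : Prop :=
  [/\ a \in tangible, corner_root f a &
      forall i, dominant f a i -> (essential_part f)`_i * a ^+ i \in tangible].

(* The exponent of the largest power of 'X dividing f (0 if f = 0). *)
Definition low_degree f : nat := find (predC1 0) f.

(* The unit and monomial factor of f, equal to 1 when f is monic with nonzero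
   constant term. It is invisible to the ordinary roots, which are nonzero and
   do not change when f is scaled by a tangible constant. *)
Definition monomial_factor f : {poly R} := lead_coef f *: 'X^(low_degree f).

End Semirings.

(* Main.v *)
Require Import Defs.
From HB Require Import structures.
From mathcomp Require Import all_boot all_order all_algebra.
From mathcomp Require Import boolp.
Set Implicit Arguments.
Unset Strict Implicit.
Unset Printing Implicit Defensive.
Import GRing.Theory.
Local Open Scope ring_scope.

(** Write [a <=v b] when the nu-value of [a] is at most that of [b]. The idea
    is the Newton polygon. At a tangible point [x] where one monomial of [f]
    has strictly the largest nu-value, [f] agrees with that monomial, and the
    essential monomials are exactly those that win in this way somewhere. As
    [x] grows, the winning exponent climbs through the essential exponents
    [i_0 < i_1 < ... < i_k]; it passes from [i = i_s] to [t = i_(s+1)] at the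
    points [r] with [r ^+ (t - i)] of the same nu-value as [f`_i / f`_t], and
    these [r] are ordinary roots of [f] because all coefficients of [f] are
    tangible.

    For each such pair choose [t - i] of these roots whose product is exactly
    [f`_i / f`_t] ([factorization_by_nu_roots]), and let [g] be the product of
    all the [('X + r%:P)], times the monomial factor of [f]. Strict dominance
    is multiplicative: if [c *: 'X^i] strictly dominates one factor at [x] and
    [d *: 'X^j] the other, then the product is strictly dominated at [x] by
    its monomial of exponent [i + j], whose coefficient is exactly [c * d]
    ([strictly_dominantM]). The factor ['X + r%:P] contributes ['X] when
    [r <v x] and [r%:P] when [x <v r]. Hence wherever a monomial of [f]
    strictly dominates, the monomial of [g] of the same exponent does, and the
    quotients of consecutive coefficients telescope to give it the same
    coefficient ([factors_above]). No other monomial of [g] is essential,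
    since strict dominance is an open condition and [f] has a strictly
    dominant monomial at points arbitrarily near any given one. So the
    tangible part of [g] is the essential part of [f]
    ([tangible_part_eq_essential_part]).

    It remains that a polynomial is e-equivalent to its essential part
    ([e_equiv_essential_part]). The largest exponent among the monomials of
    maximal nu-value at [x] wins alone slightly above [x], and the smallest
    one slightly below [x], so both are essential; dropping the inessential
    monomials therefore changes neither the maximal nu-value at [x] nor
    whether it is attained only once. Points slightly above and below [x]
    exist because the value group is divisible and nontrivial. *)
Section SupertropicalSemifield.
Variables (F : comNzSemiRingType) (G0 : {pred F}) (nu : F -> F).
Hypothesis hF : supertropical_semifield G0 nu.

Let hD := stfield_domain hF.
Let hS := stdom_semiring hD.
Local Notation T := (tangible G0).
Implicit Types (a b c d e x y z : F) (f g h : {poly F}).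
Implicit Types (i j k l m n p q : nat).

(** * The total preorder of nu-values *)

Definition nule (a b : F) : bool := nu b + nu a == nu b.
Definition nult (a b : F) : bool := ~~ nule b a.

Local Notation "a <=v b" := (nule a b) (at level 70, no associativity).
Local Notation "a <v b" := (nult a b) (at level 70, no associativity).

Lemma nule_refl a : a <=v a.
Proof. by rewrite /nule (st_addaa hS) (nu_idem hS). Qed.

Lemma nule_trans b a c : a <=v b -> b <=v c -> a <=v c.
Proof.
by move=> /eqP ab /eqP bc; apply/eqP; rewrite -{1}bc -addrA ab bc.
Qed.

Lemma nule_total a b : (a <=v b) || (b <=v a).
Proof.
have [eq_ab|neq_ab] := eqVneq (nu a) (nu b).
  by rewrite /nule eq_ab (st_addaa hS) (nu_idem hS) eqxx.
have : nu (nu a) <> nu (nu b) by rewrite !(nu_idem hS); apply/eqP.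
by move=> /(st_add_neq hS) [] E; rewrite /nule E addrC E eqxx ?orbT.
Qed.

Lemma nule_anti a b : a <=v b -> b <=v a -> nu a = nu b.
Proof. by move=> /eqP ab /eqP <-; rewrite addrC. Qed.

Lemma nule_congr a b a' b' :
  nu a = nu a' -> nu b = nu b' -> (a <=v b) = (a' <=v b').
Proof. by rewrite /nule => -> ->. Qed.

Lemma nult_congr a b a' b' :
  nu a = nu a' -> nu b = nu b' -> (a <v b) = (a' <v b').
Proof. by rewrite /nult /nule => -> ->. Qed.

Lemma eq_nule a b : nu a = nu b -> a <=v b.
Proof. by move=> /nule_congr/(_ erefl) ->; exact: nule_refl. Qed.

Lemma nultW a b : a <v b -> a <=v b.
Proof. by have := nule_total a b; rewrite /nult; case: (b <=v a); rewrite ?orbF. Qed.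

Lemma nult_irr a : (a <v a) = false.
Proof. by rewrite /nult nule_refl. Qed.

Lemma nule_lt_trans b a c : a <=v b -> b <v c -> a <v c.
Proof. by move=> ab; apply: contraNN => /nule_trans; apply. Qed.

Lemma nult_le_trans b a c : a <v b -> b <=v c -> a <v c.
Proof. by move=> ab bc; apply: contraNN ab; exact: nule_trans. Qed.

Lemma nult_trans b a c : a <v b -> b <v c -> a <v c.
Proof. by move=> /nultW; exact: nule_lt_trans. Qed.

Lemma nu_gtE a b : nu_gt nu a b <-> b <v a.
Proof.
split=> [[/eqP ba neq_ab]|lt_ba].
  by apply/negP => ab; apply: neq_ab; exact: nule_anti.
split; first by apply/eqP; exact: nultW.
by move=> eq_ab; move: lt_ba; rewrite /nult eq_nule.
Qed.

Lemma tangible_neq0 a : a \in T -> a != 0.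
Proof. by apply: contraTneq => ->; rewrite inE (ghost0 hS). Qed.

Lemma tangibleX a n : a \in T -> a ^+ n \in T.
Proof.
move=> aT; elim: n => [|n IHn]; first by rewrite expr0 (tangible1 hD).
by rewrite exprS (tangibleM hD).
Qed.

(** A tangible element has a nonzero nu-value by assumption; a ghost is its own
    nu-value, because the unit of the ghost ideal is [nu 1 = 1 + 1]. *)
Lemma nu_neq0 a : a != 0 -> nu a != 0.
Proof.
have [aT _|] := boolP (a \in T); first exact/eqP/(nu_tangible_neq0 hD).
rewrite inE negbK => aG; suff -> : nu a = a by [].
by rewrite -(st_addaa hS) -{1 2}(mul1r a) -mulrDl (st_addaa hS) (nu1_unit hS).
Qed.

Lemma nule0 a : 0 <=v a.
Proof. by rewrite /nule (nu0 hS) addr0. Qed.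

Lemma nult0 a : (0 <v a) = (a != 0).
Proof.
rewrite /nult /nule (nu0 hS) add0r; congr (~~ _).
apply/eqP/eqP => [nua0|->]; last exact: nu0 hS.
by apply/eqP; apply: contraTT isT => /nu_neq0; rewrite nua0 eqxx.
Qed.

Lemma nult_neq0 a b : a <v b -> b != 0.
Proof. by rewrite -nult0; apply: nule_lt_trans; exact: nule0. Qed.

(** Questions about nu-values at a nonzero point reduce to tangible points,
    which are invertible. *)
Lemma tangible_lift a : a != 0 -> exists2 t, t \in T & nu t = nu a.
Proof.
by move=> /nu_neq0/eqP; apply: (nu_tangible_onto hD); exact: (nu_ghost hS).
Qed.

Lemma nu_inverse c : c != 0 -> exists2 d, d \in T & nu (c * d) = nu 1.
Proof.
move=> /tangible_lift [t tT nut]; have [d dT td] := tangibleV hF tT.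
by exists d => //; rewrite (nuM hS) -nut -(nuM hS) td.
Qed.

Lemma nule_mul2r c a b : a <=v b -> a * c <=v b * c.
Proof. by rewrite /nule !(nuM hS) -mulrDl => /eqP ->. Qed.

Lemma nult_mul2rK c a b : a * c <v b * c -> a <v b.
Proof. by apply: contraNN; exact: nule_mul2r. Qed.

Lemma nu_mulK c d a : nu (c * d) = nu 1 -> nu (a * c * d) = nu a.
Proof. by move=> cd; rewrite -mulrA (nuM hS) cd -(nuM hS) mulr1. Qed.

Lemma nult_mul2r c a b : c != 0 -> a <v b -> a * c <v b * c.
Proof.
move=> /nu_inverse [d _ cd]; apply: contraNN => /(nule_mul2r d).
by rewrite (nule_congr (nu_mulK _ cd) (nu_mulK _ cd)).
Qed.

Lemma nu_mulf_neq0 a b : a != 0 -> b != 0 -> a * b != 0.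
Proof.
by move=> a0 b0; rewrite -nult0 -(mul0r b); apply: nult_mul2r; rewrite ?nult0.
Qed.

Lemma nu_expf_neq0 a n : a != 0 -> a ^+ n != 0.
Proof.
move=> a0; elim: n => [|n IHn]; first by rewrite expr0 oner_neq0.
by rewrite exprS nu_mulf_neq0.
Qed.

Lemma nule_mul a b c d : a <=v b -> c <=v d -> a * c <=v b * d.
Proof.
move=> ab cd; apply: (@nule_trans (b * c)); first exact: nule_mul2r.
by rewrite ![b * _]mulrC; exact: nule_mul2r.
Qed.

Lemma nult_le_mul a b c d : d != 0 -> a <v b -> c <=v d -> a * c <v b * d.
Proof.
move=> d0 ab cd; apply: (@nule_lt_trans (a * d)); last exact: nult_mul2r.
exact: nule_mul (nule_refl a) cd.
Qed.

Lemma nule_exp n a b : a <=v b -> a ^+ n <=v b ^+ n.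
Proof.
move=> ab; elim: n => [|n IHn]; first exact: nule_refl.
by rewrite !exprS nule_mul.
Qed.

Lemma nult_exp n a b : (0 < n)%N -> a <v b -> a ^+ n <v b ^+ n.
Proof.
case: n => // n _ ab; rewrite !exprS; apply: nult_le_mul => //.
  exact/nu_expf_neq0/(nult_neq0 ab).
exact/nule_exp/nultW.
Qed.

(** The value group is torsion-free because it is ordered, although the group
    of tangible elements may have torsion. *)
Lemma nu_exp_inj n a b : (0 < n)%N -> nu (a ^+ n) = nu (b ^+ n) -> nu a = nu b.
Proof.
move=> n0 eq_n; apply: nule_anti; rewrite -[_ <=v _]negbK; apply/negP.
  by move=> /(nult_exp n0); rewrite (nult_congr erefl eq_n) nult_irr.
by move=> /(nult_exp n0); rewrite (nult_congr eq_n erefl) nult_irr.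
Qed.

Lemma nule_exp2l e p q : 1 <=v e -> (p <= q)%N -> e ^+ p <=v e ^+ q.
Proof.
move=> e1 /subnKC <-; rewrite exprD -{1}[e ^+ p]mulr1.
apply: nule_mul; first exact: nule_refl.
by rewrite -{1}(expr1n F (q - p)); exact: nule_exp.
Qed.

Lemma nult_exp2l e p q : 1 <v e -> (p < q)%N -> e ^+ p <v e ^+ q.
Proof.
move=> e1 pq; apply: (@nult_le_trans (e ^+ p.+1)); last first.
  by apply: nule_exp2l => //; exact: nultW.
rewrite exprS -{1}[e ^+ p]mul1r; apply: nult_mul2r => //.
exact/nu_expf_neq0/(nult_neq0 e1).
Qed.

Lemma nuX_congr a b c n :
  nu a = nu b -> nu (c * a ^+ n) = nu (c * b ^+ n).
Proof.
move=> ab; rewrite !(nuM hS); congr (_ * _); elim: n => // n IHn.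
by rewrite !exprS !(nuM hS) ab IHn.
Qed.

(** * Sums with a strictly dominant term *)

Lemma add_absorb a b : a <v b -> b + a = b.
Proof.
move=> ab; have neq : nu b <> nu a.
  by move=> eq_ba; move: ab; rewrite (nult_congr erefl eq_ba) nult_irr.
case: (st_add_neq hS neq) => // E.
by case: neq; rewrite -(eqP (nultW ab)) -(nuD hS) E.
Qed.

Lemma nule_add a b c : a <=v c -> b <=v c -> a + b <=v c.
Proof. by rewrite /nule (nuD hS) addrA => /eqP -> /eqP ->. Qed.

Lemma nult_add a b c : a <v c -> b <v c -> a + b <v c.
Proof.
move=> ac bc; case/orP: (nule_total a b) => [ab|ba].
  by apply: nule_lt_trans bc; apply: nule_add => //; exact: nule_refl.
by apply: nule_lt_trans ac; apply: nule_add => //; exact: nule_refl.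
Qed.

Lemma nule_sum I (r : seq I) (P : pred I) (v : I -> F) c :
  (forall i : I, P i -> v i <=v c) -> \sum_(i <- r | P i) v i <=v c.
Proof. by move=> h; elim/big_ind: _ => //; [exact: nule0|move=> ? ?; exact: nule_add]. Qed.

Lemma nult_sum I (r : seq I) (P : pred I) (v : I -> F) c : c != 0 ->
  (forall i : I, P i -> v i <v c) -> \sum_(i <- r | P i) v i <v c.
Proof.
move=> c0 h; elim/big_ind: _ => //; first by rewrite nult0.
by move=> ? ?; exact: nult_add.
Qed.

Lemma sum_strict_max (I : finType) (P : pred I) (v : I -> F) (i : I) : P i ->
  v i != 0 -> (forall j : I, P j -> j != i -> v j <v v i) -> \sum_(j | P j) v j = v i.
Proof.
move=> Pi vi0 h; rewrite (bigD1 i) //=; apply: add_absorb.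
by apply: nult_sum => // j /andP[]; exact: h.
Qed.

Lemma sum_tied_max (I : finType) (P : pred I) (v : I -> F) (i k : I) :
    P i -> P k -> k != i -> nu (v k) = nu (v i) ->
    (forall j : I, P j -> v j <=v v i) -> \sum_(j | P j) v j = nu (v i).
Proof.
move=> Pi Pk ki eq_ki h; rewrite (bigD1 i) //=; apply: st_add_eq hS _ _ _.
apply: nule_anti; last by apply: nule_sum => j /andP[/h].
rewrite (bigD1 k) ?Pk //= /nule (nuD hS) eq_ki.
rewrite addrAC (st_addaa hS) (nu_idem hS) eqxx.
by [].
Qed.

(** * Monomials that strictly dominate at a point *)

Definition strictly_dominant g x i : Prop :=
  forall j, j != i -> g`_j * x ^+ j <v g`_i * x ^+ i.

(** The index [j] in the definition of strict dominance ranges over all of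
    [nat], so that comparison with a zero coefficient makes the dominant value
    nonzero. *)
Lemma strictly_dominant_neq0 g x i :
  strictly_dominant g x i -> g`_i * x ^+ i != 0.
Proof. by move=> /(_ i.+1); rewrite neq_ltn ltnSn orbT => /(_ isT)/nult_neq0. Qed.

Lemma strictly_dominant_coef_neq0 g x i : strictly_dominant g x i -> g`_i != 0.
Proof. by move/strictly_dominant_neq0; apply: contraNneq => ->; rewrite mul0r. Qed.

Lemma strictly_dominant_inj g x i j :
  strictly_dominant g x i -> strictly_dominant g x j -> i = j.
Proof.
move=> hi hj; apply/eqP; apply: contraTT isT => neq_ij.
have neq_ji : j != i by rewrite eq_sym.
by have := nult_trans (hj _ neq_ij) (hi _ neq_ji); rewrite nult_irr.
Qed.

Lemma strictly_dominant_congr g x y i : nu x = nu y ->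
  strictly_dominant g x i -> strictly_dominant g y i.
Proof.
by move=> xy h j /h; rewrite (nult_congr (nuX_congr _ _ xy) (nuX_congr _ _ xy)).
Qed.

Lemma strictly_dominantP g x i : x != 0 -> g`_i != 0 ->
  (forall j, (j < size g)%N -> j != i -> g`_j * x ^+ j <v g`_i * x ^+ i) ->
  strictly_dominant g x i.
Proof.
move=> x0 gi0 h j ji; have [/h|lej] := ltnP j (size g); first exact.
by rewrite nth_default // mul0r nult0 nu_mulf_neq0 ?nu_expf_neq0.
Qed.

(** In the convolution sum for the coefficient of ['X^(i + j)] the term
    [g`_i * h`_j] exceeds every other term, so the sum equals that term, with
    no ghost created. *)
Lemma strictly_dominantM g h x i j : x != 0 ->
    strictly_dominant g x i -> strictly_dominant h x j ->
  strictly_dominant (g * h) x (i + j) /\ (g * h)`_(i + j) = g`_i * h`_j.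
Proof.
move=> x0 gi hj.
have neq0 := nu_mulf_neq0 (strictly_dominant_neq0 gi) (strictly_dominant_neq0 hj).
have term (p q : nat) : (p, q) != (i, j) ->
    g`_p * h`_q * x ^+ (p + q) <v g`_i * h`_j * x ^+ (i + j).
  rewrite !exprD !(mulrACA _ _ (x ^+ _)) xpair_eqE negb_and.
  have [->|pi _] /= := eqVneq p i.
    move=> qj; rewrite ![g`_i * _ * _]mulrC; apply: nult_le_mul (nule_refl _).
      exact: strictly_dominant_neq0.
    exact: hj.
  apply: nult_le_mul; [exact: strictly_dominant_neq0|exact: gi|].
  by have [->|/hj/nultW] := eqVneq q j; [exact: nule_refl|].
have top : (g * h)`_(i + j) = g`_i * h`_j.
  have lti : (i < (i + j).+1)%N by rewrite ltnS leq_addr.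
  rewrite coefM (@sum_strict_max _ _ _ (Ordinal lti)) //= ?addKn //.
    by rewrite nu_mulf_neq0 ?(strictly_dominant_coef_neq0 gi) ?(strictly_dominant_coef_neq0 hj).
  move=> p _ pi; apply: (@nult_mul2rK (x ^+ (i + j))).
  have := term p (i + j - p)%N; rewrite xpair_eqE negb_and subnKC -1?ltnS //.
  by apply; apply/orP; left.
split=> // k kij; rewrite top coefM mulr_suml; apply: nult_sum.
  by rewrite exprD mulrACA.
move=> p _; have := term p (k - p)%N; rewrite subnKC -1?ltnS //; apply.
by apply: contra kij => /eqP [<- <-]; rewrite subnKC -1?ltnS.
Qed.

Lemma strictly_dominant_cXn c n x :
  c != 0 -> x != 0 -> strictly_dominant (c *: 'X^n) x n.
Proof.
move=> c0 x0 j jn; rewrite !coefZ !coefXn eqxx (negPf jn) mulr0 mul0r mulr1.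
by rewrite nult0 nu_mulf_neq0 ?nu_expf_neq0.
Qed.

Lemma strictly_dominant_prod_below (s : seq F) x : x != 0 ->
    {in s, forall r, r <v x} ->
  strictly_dominant (\prod_(r <- s) ('X + r%:P)) x (size s) /\
  (\prod_(r <- s) ('X + r%:P))`_(size s) = 1.
Proof.
move=> x0; elim: s => [_|r s IHs hs].
  by rewrite big_nil -(expr0 'X) -[_ ^+ 0]scale1r; split;
    [exact/strictly_dominant_cXn/x0/oner_neq0|rewrite coefZ coefXn mulr1].
have [|sds cs] := IHs; first by move=> t ts; apply: hs; rewrite inE ts orbT.
have rx : r <v x by apply: hs; rewrite inE eqxx.
rewrite big_cons /= -add1n.
have sdr : strictly_dominant ('X + r%:P) x 1.
  move=> j j1; rewrite !coefD !coefX !coefC (negPf j1) addr0 add0r mul1r.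
  by case: eqP => [->|_]; rewrite ?expr0 ?mulr1 // mul0r nult0.
have [sd ->] := strictly_dominantM x0 sdr sds; split=> //.
by rewrite cs coefD coefX coefC addr0 mulr1.
Qed.

Lemma strictly_dominant_prod_above (s : seq F) x : x != 0 ->
    {in s, forall r, x <v r} ->
  strictly_dominant (\prod_(r <- s) ('X + r%:P)) x 0 /\
  (\prod_(r <- s) ('X + r%:P))`_0 = \prod_(r <- s) r.
Proof.
move=> x0; elim: s => [_|r s IHs hs].
  by rewrite !big_nil -(expr0 'X) -[_ ^+ 0]scale1r; split;
    [exact/strictly_dominant_cXn/x0/oner_neq0|rewrite coefZ coefXn mulr1].
have [|sds cs] := IHs; first by move=> t ts; apply: hs; rewrite inE ts orbT.
have xr : x <v r by apply: hs; rewrite inE eqxx.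
rewrite !big_cons /= -[0%N]/(0 + 0)%N.
have sdr : strictly_dominant ('X + r%:P) x 0.
  move=> j j0; rewrite !coefD !coefX !coefC (negPf j0) addr0 add0r mulr1.
  by case: eqP => [->|_]; rewrite ?mul1r // mul0r nult0 (nult_neq0 xr).
have [sd ->] := strictly_dominantM x0 sdr sds; split=> //.
by rewrite cs coefD coefX coefC add0r.
Qed.

(** * Strictly dominant monomials near a point, near 0 and near infinity *)

Hypothesis hdiv : divisibly_closed F.
Hypothesis hnontriv : exists2 a : F, a \in T & nu a <> nu 1.

Definition above1 e : bool := (e \in T) && (1 <v e).

Lemma above1_exists : exists e, above1 e.
Proof.
have [a aT neq1] := hnontriv.
have [lt1a|le_a1] := boolP (1 <v a); first by exists a; rewrite /above1 aT.
have [b bT ab] := tangibleV hF aT; exists b; rewrite /above1 bT /=.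
rewrite -ab -{2}[b]mul1r; apply: nult_mul2r; first exact: tangible_neq0.
by apply/negP => le_1a; apply: neq1; apply: nule_anti => //; exact: negbNE.
Qed.

(** The value group need not be Archimedean, so powers of one element above 1
    do not suffice to exceed [w]: a tangible lift of [w] itself is used. *)
Lemma above1_gt w : exists2 z, above1 z & w <v z.
Proof.
have [e /andP[eT e1]] := above1_exists.
have [le_w1|] := boolP (w <=v 1).
  by exists e; [rewrite /above1 eT|exact: nule_lt_trans e1].
rewrite -/(1 <v w) => lt_1w; have [t tT nut] := tangible_lift (nult_neq0 lt_1w).
have lt_we : w <v w * e.
  by rewrite mulrC -{1}[w]mul1r; apply: nult_mul2r => //; exact: nult_neq0 lt_1w.
have eq_te : nu (w * e) = nu (t * e) by rewrite !(nuM hS) nut.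
exists (t * e); last by rewrite -(nult_congr erefl eq_te).
rewrite /above1 (tangibleM hD) //= -(nult_congr erefl eq_te).
exact: nult_trans lt_we.
Qed.

(** Roots exist only up to nu-value: divisible closedness provides [b] with
    [c ^+ n = b ^+ (m * n)], which leaves a torsion factor between [c] and
    [b ^+ m]. *)
Lemma nu_root_exists c m : c \in T -> (0 < m)%N ->
  exists2 b, b \in T & nu (b ^+ m) = nu c.
Proof.
move=> cT m0; have [b [n n0 eq_cb]] := hdiv c m0.
have {}eq_cb : c ^+ n = (b ^+ m) ^+ n by rewrite -exprM -eq_cb mul1n.
exists b; last by apply: (nu_exp_inj n0); rewrite eq_cb.
apply: contraTT (tangibleX n cT) => bG; rewrite inE negbK eq_cb.
rewrite inE negbK in bG; rewrite -exprM -(prednK (_ : 0 < m * n)%N) ?muln_gt0 ?m0 //.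
by rewrite exprSr; exact: (ghostM hS).
Qed.

(** Finitely many properties that each hold eventually hold eventually
    together. The relation [R] is [nule] for neighbourhoods of 1 and its
    converse for neighbourhoods of infinity. *)
Lemma finite_bound (S : pred F) (R : rel F) (P : nat -> F -> Prop) n :
    transitive R -> total R -> (exists z, S z) ->
    (forall j, (j < n)%N -> exists2 z, S z & forall y, S y -> R y z -> P j y) ->
  exists2 z, S z & forall y, S y -> R y z -> forall j, (j < n)%N -> P j y.
Proof.
move=> Rtr Rtot [z0 Sz0]; elim: n => [_|n IHn hP]; first by exists z0.
have [|z Sz hz] := IHn; first by move=> j jn; apply: hP; exact: ltnW.
have [w Sw hw] := hP n (leqnn _).
have [u [Su uz uw]] : exists u, [/\ S u, R u z & R u w].
  case/orP: (Rtot z w) => [zw|wz]; [exists z|exists w]; split=> //.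
    by have := Rtot z z; rewrite orbb.
  by have := Rtot w w; rewrite orbb.
exists u => // y Sy yu j; rewrite ltnS leq_eqVlt => /predU1P[->|jn].
  by apply: hw => //; exact: Rtr uw.
by apply: hz => //; exact: Rtr uz.
Qed.

(** Moving the point by a factor [e] close to 1 preserves a strict inequality
    between monomials, and turns a tie into a strict inequality in favour of
    the larger exponent. For the first, a bound [z] with [z ^+ p.+1] of the
    nu-value of [b / a] leaves room for [e ^+ p]. *)
Lemma eventually_near1 a b p q : b != 0 -> a <=v b -> (p < q)%N || (a <v b) ->
  exists2 z, above1 z & forall e, above1 e -> e <=v z -> a * e ^+ p <v b * e ^+ q.
Proof.
move=> b0 ab /orP[pq|lt_ab].
  have [z z1] := above1_exists; exists z => // e /andP[_ e1] _.
  rewrite mulrC [b * _]mulrC; apply: nult_le_mul => //; exact: nult_exp2l.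
have [a0|a0] := eqVneq a 0.
  have [z z1] := above1_exists; exists z => // e /andP[_ e1] _.
  by rewrite a0 mul0r nult0 nu_mulf_neq0 ?nu_expf_neq0 ?(nult_neq0 e1).
have [d dT ad] := nu_inverse a0.
have [c cT nuc] : exists2 c, c \in T & nu c = nu (b * d).
  by apply: tangible_lift; rewrite nu_mulf_neq0 ?(tangible_neq0 dT).
have nuac : nu (a * c) = nu b.
  by rewrite (nuM hS) nuc -(nuM hS) mulrCA (nuM hS) ad -(nuM hS) mulr1.
have c1 : 1 <v c.
  rewrite -(nult_congr ad (esym nuc)).
  by apply: nult_mul2r => //; exact: tangible_neq0.
have [z zT nuz] := nu_root_exists cT (ltn0Sn p).
have z1 : 1 <v z.
  apply/negP => /(nule_exp p.+1); rewrite expr1n.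
  by rewrite (nule_congr nuz erefl) (negPf c1).
exists z; first exact/andP.
move=> e /andP[eT e1] ez.
apply: (@nule_lt_trans (a * z ^+ p)).
  by apply: nule_mul (nule_refl a) _; exact: nule_exp.
apply: (@nult_le_trans b); last first.
  rewrite -{1}[b]mulr1 -(expr0 e); apply: nule_mul (nule_refl b) _.
  by apply: nule_exp2l => //; exact: nultW.
have nuaz : nu (a * z ^+ p.+1) = nu b by rewrite (nuM hS) nuz -(nuM hS).
rewrite -(nult_congr erefl nuaz) ![a * _]mulrC; apply: nult_mul2r => //.
exact: nult_exp2l.
Qed.

Lemma eventually_large a b p q : b != 0 -> (p < q)%N ->
  exists2 z, above1 z & forall e, above1 e -> z <=v e -> a * e ^+ p <v b * e ^+ q.
Proof.
move=> b0 pq; have [d dT bd] := nu_inverse b0.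
have [z z1 adz] := above1_gt (a * d); exists z => // e /andP[_ e1] ze.
apply: (@nult_le_trans (b * e ^+ p.+1)); last first.
  by apply: nule_mul (nule_refl b) _; apply: nule_exp2l pq; exact: nultW.
rewrite exprS mulrA; apply: nult_mul2r; first exact/nu_expf_neq0/(nult_neq0 e1).
have nuadb : nu (a * d * b) = nu a by apply: nu_mulK; rewrite mulrC.
rewrite -(nult_congr nuadb erefl) [b * e]mulrC; apply: nult_mul2r => //.
exact: nult_le_trans ze.
Qed.

(** Inverting the variable exchanges the exponents. The estimates for large
    arguments and for arguments just above 1 thus also serve for small
    arguments and for arguments just below 1. *)
Lemma nult_invX a b d e p q : e * d = 1 ->
  a * e ^+ p <v b * e ^+ q -> a * d ^+ q <v b * d ^+ p.
Proof.
move=> ed; have d0 : d != 0.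
  by apply: contra_eq_neq ed => ->; rewrite mulr0 eq_sym oner_neq0.
move=> /(nult_mul2r (nu_expf_neq0 (p + q) d0)).
rewrite {1}exprD [(p + q)%N]addnC exprD -!mulrA.
by rewrite ![e ^+ _ * (_ * _)]mulrA -!exprMn ed !expr1n !mul1r.
Qed.

Lemma nule_rev_trans : transitive (fun a b => b <=v a).
Proof. by move=> b a c ba cb; exact: nule_trans ba. Qed.

Lemma nule_rev_total : total (fun a b => b <=v a).
Proof. by move=> a b; exact: nule_total. Qed.

Lemma strictly_dominant_above g x i : x != 0 -> g`_i != 0 ->
    (forall j, g`_j * x ^+ j <=v g`_i * x ^+ i) ->
    (forall j, (i < j)%N -> g`_j * x ^+ j <v g`_i * x ^+ i) ->
  exists2 z, above1 z &
    forall e, above1 e -> e <=v z -> strictly_dominant g (x * e) i.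
Proof.
move=> x0 gi0 le_i lt_i; have v0 := nu_mulf_neq0 gi0 (nu_expf_neq0 i x0).
pose P j e := j != i -> g`_j * (x * e) ^+ j <v g`_i * (x * e) ^+ i.
have [||||z z1 hz] := @finite_bound above1 nule P (size g).
- by move=> b a c; exact: nule_trans.
- exact: nule_total.
- exact: above1_exists.
- move=> j _; have [->|ji] := eqVneq j i.
    by have [z z1] := above1_exists; exists z => // e _ _; rewrite /P eqxx.
  have [|z z1 hz] := @eventually_near1 (g`_j * x ^+ j) _ j i v0 (le_i j).
    by move: ji; rewrite neq_ltn => /orP[->|/lt_i ->] //; rewrite orbT.
  exists z => // e e1 ez _; rewrite !exprMn !mulrA; exact: hz.
exists z => // e e1 ez; apply: strictly_dominantP => //; last first.
  by move=> j jn ji; exact: hz.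
by case/andP: e1 => /tangible_neq0 e0 _; exact: nu_mulf_neq0.
Qed.

Lemma strictly_dominant_below g x i : x != 0 -> g`_i != 0 ->
    (forall j, g`_j * x ^+ j <=v g`_i * x ^+ i) ->
    (forall j, (j < i)%N -> g`_j * x ^+ j <v g`_i * x ^+ i) ->
  exists2 y, y != 0 & strictly_dominant g y i.
Proof.
move=> x0 gi0 le_i lt_i; have v0 := nu_mulf_neq0 gi0 (nu_expf_neq0 i x0).
pose P j e := j != i ->
  g`_j * x ^+ j * e ^+ i <v g`_i * x ^+ i * e ^+ j.
have [||||z z1 hz] := @finite_bound above1 nule P (size g).
- by move=> b a c; exact: nule_trans.
- exact: nule_total.
- exact: above1_exists.
- move=> j _; have [->|ji] := eqVneq j i.
    by have [z z1] := above1_exists; exists z => // e _ _; rewrite /P eqxx.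
  have [|z z1 hz] := @eventually_near1 (g`_j * x ^+ j) _ i j v0 (le_i j).
    by move: ji; rewrite neq_ltn => /orP[/lt_i ->|->] //; rewrite orbT.
  by exists z => // e e1 ez _; exact: hz.
have [d dT zd] := tangibleV hF (proj1 (andP z1)).
have xd0 := nu_mulf_neq0 x0 (tangible_neq0 dT); exists (x * d) => //.
apply: strictly_dominantP => // j jn ji; rewrite !exprMn !mulrA.
by apply: nult_invX zd _; apply: hz => //; exact: nule_refl.
Qed.

Lemma lead_strictly_dominant g : g != 0 ->
  exists2 x, x \in T & strictly_dominant g x (size g).-1.
Proof.
move=> g0; set n := (size g).-1; have gn0 : g`_n != 0 by rewrite lead_coef_eq0.
pose P j e := j != n -> g`_j * e ^+ j <v g`_n * e ^+ n.
have [||||z z1 hz] := @finite_bound above1 (fun a b => b <=v a) P (size g).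
- exact: nule_rev_trans.
- exact: nule_rev_total.
- exact: above1_exists.
- move=> j; rewrite -(prednK (_ : 0 < size g)%N) ?size_poly_gt0 // ltnS -/n.
  rewrite leq_eqVlt => /predU1P[->|jn].
    by have [z z1] := above1_exists; exists z => // e _ _; rewrite /P eqxx.
  have [z z1 hz] := @eventually_large g`_j _ _ _ gn0 jn.
  by exists z => // e e1 ez _; exact: hz.
have [zT _] := andP z1; exists z => //; apply: strictly_dominantP => //.
  exact: tangible_neq0.
by move=> j jn ji; apply: hz => //; exact: nule_refl.
Qed.

Lemma low_degree_neq0 g : g != 0 -> g`_(low_degree g) != 0.
Proof.
move=> g0; have : has (predC1 0) g.
  apply/(has_nthP 0); exists (size g).-1; last by rewrite /= lead_coef_eq0.
  by rewrite prednK ?size_poly_gt0.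
by move/(nth_find 0).
Qed.

Lemma low_degree_le g i : g`_i != 0 -> (low_degree g <= i)%N.
Proof.
move=> gi0; rewrite leqNgt; apply/negP => /(before_find 0) /=.
by rewrite (negPf gi0).
Qed.

Lemma low_strictly_dominant g : g != 0 ->
  exists2 x, x \in T & strictly_dominant g x (low_degree g).
Proof.
move=> g0; set l := low_degree g; have gl0 : g`_l != 0 := low_degree_neq0 g0.
pose P j e := j != l -> g`_j * e ^+ l <v g`_l * e ^+ j.
have [||||z z1 hz] := @finite_bound above1 (fun a b => b <=v a) P (size g).
- exact: nule_rev_trans.
- exact: nule_rev_total.
- exact: above1_exists.
- move=> j _; have [gj0|/low_degree_le] := eqVneq g`_j 0.
    have [z z1] := above1_exists; exists z => // e /andP[eT _] _ _.
    rewrite gj0 mul0r nult0 nu_mulf_neq0 ?nu_expf_neq0 //.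
    exact: tangible_neq0.
  rewrite -/l leq_eqVlt => /predU1P[<-|lj].
    by have [z z1] := above1_exists; exists z => // e _ _; rewrite /P eqxx.
  have [z z1 hz] := @eventually_large g`_j _ _ _ gl0 lj.
  by exists z => // e e1 ez _; exact: hz.
have [d dT zd] := tangibleV hF (proj1 (andP z1)); exists d => //.
apply: strictly_dominantP => //; first exact: tangible_neq0.
by move=> j jn ji; apply: nult_invX zd _; apply: hz => //; exact: nule_refl.
Qed.

(** * Essential monomials *)

Lemma horner_monomial g i x : (monomial g i).[x] = g`_i * x ^+ i.
Proof. by rewrite hornerZ hornerXn. Qed.

(** The sum of the other monomials has the nu-value of the largest of them, so
    exceeding the sum means exceeding each of them. *)
Lemma essentialP g i :
  essential nu g i <-> exists x, strictly_dominant g x i.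
Proof.
split=> [[x]|[x hx]]; last first.
  exists x; apply/nu_gtE; rewrite horner_monomial horner_sum.
  apply: nult_sum => [|j ji]; first exact: strictly_dominant_neq0.
  by rewrite horner_monomial; exact: hx.
move/nu_gtE; rewrite horner_monomial horner_sum => hx; exists x => j ji.
have [jn|nj] := ltnP j (size g); last first.
  by rewrite nth_default // mul0r nult0 (nult_neq0 hx).
apply: nule_lt_trans hx; rewrite (bigD1 (Ordinal jn)) //= horner_monomial.
by rewrite /nule (nuD hS) addrAC (st_addaa hS) (nu_idem hS).
Qed.

Lemma essential_neq0 g i : essential nu g i -> g`_i != 0.
Proof. by case/essentialP => x /strictly_dominant_coef_neq0. Qed.

(** Only a constant monomial can dominate at 0, and it then dominates at all
    small enough tangible points as well. *)
Lemma essential_tangible g i : essential nu g i ->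
  exists2 x, x \in T & strictly_dominant g x i.
Proof.
move=> ei; have gi0 := essential_neq0 ei; case/essentialP: ei => x hx.
have [x0|x0] := eqVneq x 0; last first.
  have [t tT nut] := tangible_lift x0; exists t => //.
  exact: strictly_dominant_congr hx.
have i0 : i = 0%N.
  apply/eqP; apply: contraTT (strictly_dominant_neq0 hx) => i0.
  by rewrite x0 expr0n (negPf i0) mulr0 eqxx.
have g0 : g != 0 by apply: contraNneq gi0 => ->; rewrite coef0.
have := low_strictly_dominant g0; suff -> : low_degree g = i by [].
by apply/eqP; rewrite i0 -leqn0 low_degree_le // -i0.
Qed.

Lemma coef_sum_monomial g (P : pred nat) i :
  (\sum_(j < size g | P j) monomial g j)`_i = if P i then g`_i else 0.
Proof.
rewrite coef_sum big_mkcond /=.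
have zero j : j != i -> (if P j then (monomial g j)`_i else 0) = 0.
  by move=> ji; rewrite coefZ coefXn eq_sym (negPf ji) mulr0 if_same.
have [lt_i|le_i] := ltnP i (size g).
  rewrite (bigD1 (Ordinal lt_i)) //= big1 ?addr0; last by move=> j; exact: zero.
  by rewrite coefZ coefXn eqxx mulr1.
rewrite (nth_default _ le_i) if_same big1 // => j _; apply: zero.
by rewrite neq_ltn (leq_trans (ltn_ord j) le_i).
Qed.

Lemma coef_essential_part g i :
  (essential_part nu g)`_i = if `[< essential nu g i >] then g`_i else 0.
Proof. exact: (coef_sum_monomial g (fun i => `[< essential nu g i >])). Qed.

Lemma essential_partE g i :
  essential nu g i -> (essential_part nu g)`_i = g`_i.
Proof. by move=> ei; rewrite coef_essential_part asboolT. Qed.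

Lemma essential_part_neq0 g i :
  (essential_part nu g)`_i != 0 -> essential nu g i.
Proof. by rewrite coef_essential_part; case: asboolP; rewrite ?eqxx. Qed.

(** Ties for the maximum are broken by [R]: [leq] selects the last maximal
    index and [geq] the first. *)
Lemma extremal_maximum (R : rel nat) (v : nat -> F) (s : seq nat) :
    transitive R -> total R -> s != [::] ->
  exists2 i, i \in s &
    forall j, j \in s -> v j <=v v i /\ (v i <=v v j -> R j i).
Proof.
move=> Rtr Rtot; have Rrefl j : R j j by have := Rtot j j; rewrite orbb.
have single k j : j \in [:: k] -> v j <=v v k /\ (v k <=v v j -> R j k).
  by rewrite inE => /eqP ->; split=> // ; exact: nule_refl.
have extend k i s' :
    (forall j, j \in s' -> v j <=v v i /\ (v i <=v v j -> R j i)) ->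
    v k <=v v i -> (v i <=v v k -> R k i) ->
  forall j, j \in k :: s' -> v j <=v v i /\ (v i <=v v j -> R j i).
  by move=> hi ki rki j; rewrite inE => /predU1P[->|/hi].
elim: s => [//|k s IHs _]; have [->|/IHs[i si hi]] := eqVneq s [::].
  by exists k; [rewrite inE|exact: single].
have si' : i \in k :: s by rewrite inE si orbT.
have replace : v i <=v v k -> R i k ->
    forall j, j \in k :: s -> v j <=v v k /\ (v k <=v v j -> R j k).
  move=> ik Rik; apply: extend => // [j /hi[ji Rji]|].
    split=> [|kj]; first exact: nule_trans ik.
    by apply: Rtr Rik; apply: Rji; exact: nule_trans kj.
  exact: nule_refl.
have [ki|ik] := boolP (v k <=v v i); last first.
  exists k; first by rewrite inE eqxx.
  apply: extend => // [j /hi[ji _]|]; last exact: nule_refl.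
  have lt_jk : v j <v v k by exact: nule_lt_trans ik.
  by split=> [|kj]; [exact: nultW|case/negP: lt_jk].
have [Rki|/negPf nRki] := boolP (R k i).
  by exists i => //; exact: extend.
have [ik|nik] := boolP (v i <=v v k).
  exists k; first by rewrite inE eqxx.
  by apply: replace => //; have := Rtot i k; rewrite nRki orbF.
by exists i => //; apply: extend => // ik; rewrite ik in nik.
Qed.

Lemma extremal_dominant (R : rel nat) g x :
    transitive R -> total R -> g != 0 -> x != 0 ->
  exists2 i, g`_i != 0 & forall j, g`_j * x ^+ j <=v g`_i * x ^+ i /\
    (~~ R j i -> g`_j * x ^+ j <v g`_i * x ^+ i).
Proof.
move=> Rtr Rtot g0 x0; pose v j := g`_j * x ^+ j.
have [|i _ hi] := @extremal_maximum R v (iota 0 (size g)) Rtr Rtot.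
  by rewrite -size_eq0 size_iota size_poly_eq0.
have vi0 : v i != 0.
  have lead0 : 0 <v v (size g).-1.
    by rewrite nult0 nu_mulf_neq0 ?nu_expf_neq0 // lead_coef_eq0.
  have lead_in : (size g).-1 \in iota 0 (size g).
    by rewrite mem_iota add0n /= prednK ?size_poly_gt0.
  exact: nult_neq0 (nult_le_trans lead0 (proj1 (hi _ lead_in))).
exists i; first by apply: contraNneq vi0 => gi0; rewrite /v gi0 mul0r.
move=> j; have [jn|nj] := ltnP j (size g).
  have [|ji Rji] := hi j; first by rewrite mem_iota.
  by split=> //; apply: contraNN => /Rji.
by rewrite nth_default // mul0r; split; [exact: nule0|rewrite nult0].
Qed.

Lemma geq_trans : transitive geq.
Proof. by move=> m n p nm pm; exact: leq_trans pm nm. Qed.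

Lemma geq_total : total geq.
Proof. by move=> m n; exact: leq_total. Qed.

(** Here [i] is the last and [k] the first exponent of maximal nu-value at
    [x]: the former dominates alone just above [x], the latter just below. *)
Lemma extremal_essentials g x : g != 0 -> x != 0 ->
  exists i k, [/\ essential nu g i, essential nu g k &
    forall j, [/\ g`_j * x ^+ j <=v g`_i * x ^+ i,
      g`_j * x ^+ j <=v g`_k * x ^+ k,
      (i < j)%N -> g`_j * x ^+ j <v g`_i * x ^+ i &
      (j < k)%N -> g`_j * x ^+ j <v g`_k * x ^+ k]].
Proof.
move=> g0 x0.
have [i gi0 hi] := extremal_dominant leq_trans leq_total g0 x0.
have [k gk0 hk] := extremal_dominant geq_trans geq_total g0 x0.
have hi1 j := proj1 (hi j); have hk1 j := proj1 (hk j).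
have hi2 j : (i < j)%N -> g`_j * x ^+ j <v g`_i * x ^+ i.
  by rewrite ltnNge; exact: (proj2 (hi j)).
have hk2 j : (j < k)%N -> g`_j * x ^+ j <v g`_k * x ^+ k.
  by rewrite ltnNge; exact: (proj2 (hk j)).
exists i, k; split=> [||j]; last by split; [exact: hi1|exact: hk1|exact: hi2|exact: hk2].
  have [z z1 hz] := strictly_dominant_above x0 gi0 hi1 hi2.
  by apply/essentialP; exists (x * z); apply: hz => //; exact: nule_refl.
have [y _ hy] := strictly_dominant_below x0 gk0 hk1 hk2.
by apply/essentialP; exists y.
Qed.

(** At a nonzero point either one monomial dominates alone, and it is
    essential, or two essential monomials tie for the maximum and make both
    values equal to the same ghost. *)
Lemma e_equiv_essential_part g : e_equiv g (essential_part nu g).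
Proof.
move=> x; have [->|g0] := eqVneq g 0.
  by rewrite /essential_part size_poly0 big_ord0.
have [->|x0] := eqVneq x 0.
  rewrite !horner_coef0 coef_essential_part; case: asboolP => // ness.
  apply/eqP; apply/negPn/negP => g00; apply: ness.
  apply/essentialP; exists 0 => j j0.
  by rewrite expr0n (negPf j0) mulr0 expr0 mulr1 nult0.
have size_es : (size (essential_part nu g) <= size g)%N.
  apply/leq_sizeP => j le_j.
  by rewrite coef_essential_part nth_default // if_same.
rewrite horner_coef (horner_coef_wide _ size_es).
have [i [k [ei ek max_ik]]] := extremal_essentials g0 x0.
have lt_size j : essential nu g j -> (j < size g)%N.
  move=> /essential_neq0; apply: contraNT; rewrite -leqNgt => le_j.
  by rewrite nth_default.
pose oi := Ordinal (lt_size i ei); pose ok := Ordinal (lt_size k ek).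
have coef_le j : (essential_part nu g)`_j * x ^+ j <=v g`_j * x ^+ j.
  rewrite coef_essential_part; case: asboolP => _; first exact: nule_refl.
  by rewrite mul0r; exact: nule0.
have max_i j : g`_j * x ^+ j <=v g`_i * x ^+ i by case: (max_ik j).
have [eq_ki|neq_ki] := eqVneq k i.
  have v0 : g`_i * x ^+ i != 0.
    by rewrite nu_mulf_neq0 ?nu_expf_neq0 ?essential_neq0.
  have lt_i (j : nat) : j != i -> g`_j * x ^+ j <v g`_i * x ^+ i.
    have [_ _ hi hk] := max_ik j; rewrite eq_ki in hk.
    by rewrite neq_ltn => /orP[/hk|/hi].
  rewrite (@sum_strict_max _ _ _ oi) //= => [|j _ ji]; last exact: lt_i.
  rewrite (@sum_strict_max _ _ _ oi) //= ?essential_partE // => j _ ji.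
  by apply: nule_lt_trans (coef_le j) _; exact: lt_i.
have tied : nu (g`_k * x ^+ k) = nu (g`_i * x ^+ i).
  by apply: nule_anti => //; case: (max_ik i).
rewrite (@sum_tied_max _ _ _ oi ok) //.
rewrite (@sum_tied_max _ _ _ oi ok) //= ?essential_partE // => j _.
by apply: nule_trans (coef_le j) _; exact: max_i.
Qed.

Lemma coef_tangible_part g i :
    let es := essential_part nu g in
  (tangible_part G0 nu g)`_i = if es`_i \in T then es`_i else 0.
Proof. exact: (coef_sum_monomial _ (fun i => (essential_part nu g)`_i \in T)). Qed.

(** * Roots attached to consecutive essential monomials *)

Lemma nu_quotient x y : x != 0 -> x <=v y ->
  exists u, [/\ u != 0, 1 <=v u & nu (x * u) = nu y].
Proof.
move=> x0 xy; have [d dT xd] := nu_inverse x0; exists (y * d).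
have nuE : nu (x * (y * d)) = nu y.
  by rewrite mulrCA (nuM hS) xd -(nuM hS) mulr1.
split=> //; last by rewrite -(nule_congr xd erefl); exact: nule_mul2r.
apply: nu_mulf_neq0 (tangible_neq0 dT).
by apply: nult_neq0 (_ : 0 <v y); apply: nult_le_trans xy; rewrite nult0.
Qed.

(** Two monomials exchange order at most once: increasing the argument favours
    the larger exponent [t], decreasing it favours [i]. *)
Lemma nult_cross_up a b x y i t : (i <= t)%N -> x != 0 -> x <=v y ->
  a * x ^+ i <v b * x ^+ t -> a * y ^+ i <v b * y ^+ t.
Proof.
move=> it x0 /(nu_quotient x0)[u [u0 u1 xu]] lt_x.
rewrite -(nult_congr (nuX_congr _ _ xu) (nuX_congr _ _ xu)) !exprMn !mulrA.
by apply: nult_le_mul lt_x _; [exact: nu_expf_neq0|exact: nule_exp2l].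
Qed.

Lemma nult_cross_down a b x y i t : (i <= t)%N -> x != 0 -> x <=v y ->
  b * y ^+ t <v a * y ^+ i -> b * x ^+ t <v a * x ^+ i.
Proof.
move=> it x0 /(nu_quotient x0)[u [u0 u1 xu]].
rewrite -(nult_congr (nuX_congr _ _ xu) (nuX_congr _ _ xu)) !exprMn !mulrA.
move=> lt_y; apply: (@nult_mul2rK (u ^+ t)); apply: nult_le_trans lt_y _.
by apply: nule_mul (nule_refl _) _; exact: nule_exp2l.
Qed.

(** One element [b] with [b ^+ m] of the nu-value of [c] need not satisfy
    [b ^+ m = c]. Taking [m - 1] copies of [b] and correcting the last factor
    to [c / b ^+ (m - 1)], which has the same nu-value as [b], makes the
    product equal to [c]. *)
Lemma factorization_by_nu_roots c m : c \in T -> (0 < m)%N ->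
  exists s : seq F, [/\ size s = m, \prod_(r <- s) r = c &
    {in s, forall r, r \in T /\ nu (r ^+ m) = nu c}].
Proof.
move=> cT m0; have [b bT nub] := nu_root_exists cT m0.
case: m m0 nub => // m _ nub.
have [d dT bd] := tangibleV hF (tangibleX m bT).
have nuc : nu (c * d) = nu b.
  by rewrite (nuM hS) -nub -(nuM hS) exprS -mulrA bd mulr1.
exists (c * d :: nseq m b); split.
- by rewrite /= size_nseq.
- by rewrite big_cons big_nseq iter_mulr_1 -mulrA [d * _]mulrC bd mulr1.
move=> r; rewrite inE => /predU1P[->|/nseqP[-> _]] //.
split; first exact: (tangibleM hD).
by have := nuX_congr 1 m.+1 nuc; rewrite !mul1r nub.
Qed.

(** An edge of the Newton polygon: two consecutive essential exponents [i < t],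
    and a tangible point [r] at which their monomials tie. *)
Section Edge.
Variables (f : {poly F}) (i t : nat) (r : F).
Hypotheses (ess_i : essential nu f i) (ess_t : essential nu f t).
Hypothesis lt_it : (i < t)%N.
Hypothesis consecutive : forall k, (i < k < t)%N -> ~ essential nu f k.
Hypothesis rT : r \in T.
Hypothesis tied : nu (f`_i * r ^+ i) = nu (f`_t * r ^+ t).

(** The monomial of exponent [i] strictly dominates at some [z]. It still wins
    over [t] there, so [z <=v r], and passing from [z] up to [r] it keeps its
    advantage over every smaller exponent. Exponents above [t] are handled
    symmetrically from a point where [t] dominates. *)
Lemma edge_dominates k : essential nu f k ->
  f`_k * r ^+ k <=v f`_i * r ^+ i.
Proof.
move=> ess_k; have r0 := tangible_neq0 rT.
case: (ltngtP k i) => [ki|ik|->]; last exact: nule_refl.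
  have [z zT hz] := essential_tangible ess_i; have z0 := tangible_neq0 zT.
  have zr : z <=v r.
    rewrite -[_ <=v _]negbK; apply/negP => /nultW rz.
    have := nult_cross_down (ltnW lt_it) r0 rz (hz t _).
    by rewrite (gtn_eqF lt_it) (nult_congr erefl tied) nult_irr => /(_ isT).
  by apply/nultW/(nult_cross_up (ltnW ki) z0 zr)/hz; rewrite (ltn_eqF ki).
rewrite (nule_congr erefl tied).
case: (ltngtP k t) => [kt|tk|->]; last exact: nule_refl.
  by case: (consecutive _ ess_k); rewrite ik kt.
have [y yT hy] := essential_tangible ess_t; have y0 := tangible_neq0 yT.
have ry : r <=v y.
  rewrite -[_ <=v _]negbK; apply/negP => /nultW yr.
  have := nult_cross_up (ltnW lt_it) y0 yr (hy i _).
  by rewrite (ltn_eqF lt_it) (nult_congr tied erefl) nult_irr => /(_ isT).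
by apply/nultW/(nult_cross_down (ltnW tk) r0 ry)/hy; rewrite (gtn_eqF tk).
Qed.

(** If [x <=v r], the advantage of [j] over [i] at [x] would persist at [r],
    where [i] is maximal. *)
Lemma edge_root_below x j : x \in T -> strictly_dominant f x j -> (i < j)%N ->
  r <v x.
Proof.
move=> xT hj ij; apply/negP => xr.
have ess_j : essential nu f j by apply/essentialP; exists x.
have := nult_cross_up (ltnW ij) (tangible_neq0 xT) xr (hj i _).
by rewrite (ltn_eqF ij) => /(_ isT)/negP; apply; exact: edge_dominates.
Qed.

Lemma edge_root_above x j : x \in T -> strictly_dominant f x j -> (j < t)%N ->
  x <v r.
Proof.
move=> xT hj jt; apply/negP => rx.
have ess_j : essential nu f j by apply/essentialP; exists x.
have := nult_cross_down (ltnW jt) (tangible_neq0 rT) rx (hj t _).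
rewrite (gtn_eqF jt) -(nult_congr tied erefl) => /(_ isT)/negP; apply.
exact: edge_dominates.
Qed.

Lemma edge_root_ordinary : tangible_poly G0 f -> ordinary_root G0 nu f r.
Proof.
move=> hf.
have dom k : essential nu f k -> nu (f`_k * r ^+ k) = nu (f`_i * r ^+ i) ->
    dominant nu f r k.
  move=> ess_k nuk; split; first by rewrite essential_partE // essential_neq0.
  move=> j /essential_part_neq0 ess_j; rewrite !essential_partE //.
  apply/eqP; rewrite -/(nule _ _) (nule_congr erefl nuk).
  exact: edge_dominates.
split=> // [|k [ess_k _]].
  exists i, t; split; [|exact: dom|exact: dom].
  by move=> it; move: lt_it; rewrite it ltnn.
apply: (tangibleM hD) (tangibleX k rT).
have /essential_part_neq0 ess := ess_k.
by rewrite essential_partE // hf // essential_neq0.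
Qed.

End Edge.

(** * The factorization *)

Lemma strictly_dominant_le_degree g x j :
  strictly_dominant g x j -> (j <= (size g).-1)%N.
Proof.
move=> /strictly_dominant_coef_neq0 gj0; rewrite -ltnS.
have [|/(nth_default 0) gj] := ltnP j (size g); last by rewrite gj eqxx in gj0.
by move=> jn; apply: leq_trans jn (leqSpred _).
Qed.

(** Descending induction on the essential exponent [i]: the roots of the edge
    from [i] to the next essential exponent [t] are added to those obtained
    for [t]. The maximum with [i] covers the points where [f] is dominated by
    an exponent at most [i]: all the roots collected so far exceed these
    points, and their product is [f`_i / lead_coef f]. *)
Lemma factors_above f i : tangible_poly G0 f -> essential nu f i ->
  exists s : seq F, {in s, forall r, ordinary_root G0 nu f r} /\
    forall x j, x \in T -> strictly_dominant f x j ->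
      let Q := \prod_(r <- s) ('X + r%:P) in
      strictly_dominant Q x (maxn i j - i) /\
      lead_coef f * Q`_(maxn i j - i) = f`_(maxn i j).
Proof.
move=> hf; have [m le_m] := ubnP ((size f).-1 - i); elim: m => // m IHm in i le_m *.
move=> ess_i.
have f0 : f != 0 by apply: contraNneq (essential_neq0 ess_i) => ->; rewrite coef0.
have [le_ni|lt_in] := leqP (size f).-1 i.
  exists [::]; split=> // x j xT hj; rewrite big_nil /=.
  have [z zT hz] := essential_tangible ess_i.
  have eq_i : i = (size f).-1.
    by apply/eqP; rewrite eqn_leq le_ni (strictly_dominant_le_degree hz).
  have /maxn_idPl -> : (j <= i)%N by rewrite eq_i (strictly_dominant_le_degree hj).
  rewrite subnn coef1 mulr1 eq_i; split=> //.
  rewrite -(expr0 'X) -[_ ^+ 0]scale1r.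
  by apply: strictly_dominant_cXn; [exact: oner_neq0|exact: tangible_neq0].
pose above k := `[< essential nu f k >] && (i < k)%N.
have ex_above : exists k, above k.
  exists (size f).-1; rewrite /above lt_in andbT; apply/asboolP/essentialP.
  by have [z _ hz] := lead_strictly_dominant f0; exists z.
have [t /andP[/asboolP ess_t lt_it] min_t] := ex_minnP ex_above.
have consecutive k : (i < k < t)%N -> ~ essential nu f k.
  move=> /andP[ik kt] ess_k; have := min_t k.
  by rewrite /above ik asboolT // leqNgt kt => /(_ isT).
have [|s [ord_s hs]] := IHm t _ ess_t.
  exact: leq_trans (ltn_sub2l lt_in lt_it) _.
have fiT : f`_i \in T by rewrite hf ?essential_neq0.
have ftT : f`_t \in T by rewrite hf ?essential_neq0.
have [d dT td] := tangibleV hF ftT.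
have cT := tangibleM hD fiT dT.
have tc : f`_t * (f`_i * d) = f`_i by rewrite mulrCA td mulr1.
have ti0 : (0 < t - i)%N by rewrite subn_gt0.
have [s' [size_s' prod_s' hs']] := factorization_by_nu_roots cT ti0.
have tied r : r \in s' -> nu (f`_i * r ^+ i) = nu (f`_t * r ^+ t).
  move=> /hs'[_ nur]; rewrite -{2}(subnK (ltnW lt_it)) exprD mulrA.
  by rewrite !(nuM hS) nur -!(nuM hS) tc.
have s'T r : r \in s' -> r \in T by case/hs'.
exists (s' ++ s); split=> [r|x j xT hj].
  rewrite mem_cat => /orP[rs'|/ord_s //].
  have [rT r_tied] := (s'T r rs', tied r rs').
  exact: edge_root_ordinary ess_i ess_t lt_it consecutive rT r_tied hf.
rewrite big_cat /=; have x0 := tangible_neq0 xT.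
have [sdQ coefQ] := hs x j xT hj.
have [le_ji|lt_ij] := leqP j i.
  have below : {in s', forall r, x <v r}.
    move=> r rs'.
    apply: edge_root_above (s'T r rs') (tied r rs') _ _ xT hj _ => //.
    exact: leq_ltn_trans lt_it.
  have [sdQ' coefQ'] := strictly_dominant_prod_above x0 below.
  move: sdQ coefQ; rewrite (maxn_idPl (ltnW (leq_ltn_trans le_ji lt_it))) !subnn.
  move=> sdQ coefQ; have [sd coefs] := strictly_dominantM x0 sdQ' sdQ.
  split=> //; rewrite -[0%N]/(0 + 0)%N coefs coefQ' prod_s' mulrCA coefQ.
  by rewrite mulrC.
have le_tj : (t <= j)%N.
  by apply: min_t; rewrite /above lt_ij andbT; apply/asboolP/essentialP; exists x.
have above_s' : {in s', forall r, r <v x}.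
  move=> r rs'; have [rT r_tied] := (s'T r rs', tied r rs').
  exact: edge_root_below lt_it consecutive rT r_tied _ _ xT hj lt_ij.
have [sdQ' coefQ'] := strictly_dominant_prod_below x0 above_s'.
move: sdQ coefQ; rewrite (maxn_idPr le_tj) => sdQ coefQ.
have [] := strictly_dominantM x0 sdQ' sdQ.
rewrite coefQ' mul1r size_s' addnC addnBA ?(ltnW lt_it) // subnK // => sd ->.
by [].
Qed.

(** An essential monomial [i] of [g] dominates at some [x], and then at all
    points slightly above [x]. At such points close enough to [x] the last
    monomial of [f] that is maximal at [x] dominates [f] alone, so by
    hypothesis its exponent also dominates [g], which forces it to be [i]. *)
Lemma tangible_part_eq_essential_part f g : f != 0 -> tangible_poly G0 f ->
    (forall x j, x \in T -> strictly_dominant f x j ->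
      strictly_dominant g x j /\ g`_j = f`_j) ->
  tangible_part G0 nu g = essential_part nu f.
Proof.
move=> f0 hf local.
have fg i : essential nu f i -> essential nu g i /\ g`_i = f`_i.
  move=> /essential_tangible[x xT hx]; have [gx ->] := local x i xT hx.
  by split=> //; apply/essentialP; exists x.
have gf i : essential nu g i -> essential nu f i.
  move=> ess_i; have [x xT hx] := essential_tangible ess_i.
  have x0 := tangible_neq0 xT.
  have [j fj0 hj] := extremal_dominant leq_trans leq_total f0 x0.
  have hj1 k := proj1 (hj k).
  have hj2 k : (j < k)%N -> f`_k * x ^+ k <v f`_j * x ^+ j.
    by rewrite ltnNge; exact: (proj2 (hj k)).
  have gi0 := strictly_dominant_coef_neq0 hx.
  have hx1 k : g`_k * x ^+ k <=v g`_i * x ^+ i.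
    by have [->|/hx/nultW] := eqVneq k i; [exact: nule_refl|].
  have hx2 k : (i < k)%N -> g`_k * x ^+ k <v g`_i * x ^+ i.
    by move=> ik; apply: hx; rewrite gtn_eqF.
  have [y y1 near_y] := strictly_dominant_above x0 fj0 hj1 hj2.
  have [z z1 near_z] := strictly_dominant_above x0 gi0 hx1 hx2.
  have [e [e1 ey ez]] : exists e, [/\ above1 e, e <=v y & e <=v z].
    by case/orP: (nule_total y z) => [yz|zy]; [exists y|exists z];
      split=> //; exact: nule_refl.
  have eT : e \in T by case/andP: e1.
  have [gj _] := local _ _ (tangibleM hD xT eT) (near_y e e1 ey).
  rewrite (strictly_dominant_inj (near_z e e1 ez) gj).
  by apply/essentialP; exists (x * e); exact: near_y.
apply/polyP => i; rewrite coef_tangible_part !coef_essential_part.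
case: (asboolP (essential nu f i)) => [ess_f|ness_f].
  have [ess_g ->] := fg i ess_f; rewrite (asboolT ess_g).
  by rewrite hf // essential_neq0.
by case: (asboolP (essential nu g i)) => [/gf //|_]; rewrite if_same.
Qed.

Lemma factorization f : f != 0 -> tangible_poly G0 f ->
  exists s : seq F, {in s, forall r, ordinary_root G0 nu f r} /\
    tangible_part G0 nu (monomial_factor f * \prod_(r <- s) ('X + r%:P))
      = essential_part nu f.
Proof.
move=> f0 hf; set l := low_degree f.
have ess_l : essential nu f l.
  by apply/essentialP; have [x _ hx] := low_strictly_dominant f0; exists x.
have [s [ord_s hs]] := factors_above hf ess_l.
exists s; split=> //; apply: tangible_part_eq_essential_part => // x j xT hj.
have x0 := tangible_neq0 xT.
have le_lj : (l <= j)%N := low_degree_le (strictly_dominant_coef_neq0 hj).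
have := hs x j xT hj; rewrite (maxn_idPr le_lj) => -[sdQ coefQ].
have lead0 : lead_coef f != 0 by rewrite lead_coef_eq0.
have [] := strictly_dominantM x0 (strictly_dominant_cXn (n := l) lead0 x0) sdQ.
by rewrite coefZ coefXn eqxx mulr1 coefQ subnKC.
Qed.

End SupertropicalSemifield.

Theorem theorem8p21 (F : comNzSemiRingType) (G0 : {pred F}) (nu : F -> F)
    (hF : supertropical_semifield G0 nu)
    (hdiv : divisibly_closed F)
    (hnontriv : exists2 a : F, a \in tangible G0 & nu a <> nu 1)
    (f : {poly F}) (hf : tangible_poly G0 f) :
  exists (n : nat) (a : 'I_n -> F) (i : 'I_n -> nat),
    (forall j, ordinary_root G0 nu f (a j)) /\
    e_equiv f
      (tangible_part G0 nu
        (monomial_factor f * \prod_(j < n) ('X + (a j)%:P) ^+ i j)).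
Proof.
have [->|f0] := eqVneq f 0.
  exists 0%N, (fun=> 0), (fun=> 0%N); split; first by case.
  move=> x; rewrite /monomial_factor lead_coef0 scale0r mul0r.
  rewrite (_ : tangible_part _ _ _ = 0) //; apply/polyP => i.
  by rewrite coef_tangible_part coef_essential_part coef0 !if_same.
have [s [ord_s tangible_s]] := factorization hF hdiv hnontriv f0 hf.
exists (size s), (fun j => s`_j), (fun=> 1%N); split=> [j|].
  by apply: ord_s; exact: mem_nth.
suff -> : \prod_(j < size s) ('X + (s`_j)%:P) ^+ 1 = \prod_(r <- s) ('X + r%:P).
  rewrite tangible_s; exact: e_equiv_essential_part hF hdiv hnontriv f.
by rewrite (big_nth 0) big_mkord; apply: eq_bigr => j _; rewrite expr1.
Qed.
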